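(* Let $E$ be a nonzero reflexive real Banach space and $S,T\colon E\rightrightarrows E^*$ be maximally monotone, and suppose $\bigcup_{\lambda>0}\lambda[\pi_1\mathrm{dom}\,\varphi_S-\pi_1\mathrm{dom}\,\varphi_T]$ is a closed linear subspace of $E$. Then $S+T$ is maximally monotone.
   Context: For a monotone multifunction $S$ with nonempty graph $G(S)$, its Fitzpatrick function is $\varphi_S(x,x^* ):=\sup_{(s,s^* )\in G(S)}[\langle x,s^*\rangle+\langle s,x^*\rangle-\langle s,s^*\rangle]$ on $E\times E^*$; $\mathrm{dom}\,\varphi_S:=\{(x,x^* )\colon\varphi_S(x,x^* )\in\mathbb{R}\}$, $\pi_1(x,x^* ):=x$. $(S+T)x:=\{y+z\colon y\in Sx,\ z\in Tx\}$. Maximal monotonicity is in the usual sense for graphs in $E\times E^*$. *)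

(* Defs.v *)
From HB Require Import structures.
From mathcomp Require Import all_boot all_order all_algebra.
From mathcomp Require Import all_classical all_reals all_analysis.
Set Implicit Arguments. Unset Strict Implicit. Unset Printing Implicit Defensive.
Import Order.TTheory GRing.Theory Num.Theory.
Import numFieldNormedType.Exports.
Local Open Scope classical_set_scope.
Local Open Scope ring_scope.

Section Defs.
Variables (R : realType) (E : normedModType R).

Definition is_dual (f : E -> R) : Prop :=
  (forall (a : R) (u v : E), f (a *: u + v) = a * f u + f v) /\ continuous f.

Definition dnorm (f : E -> R) : R := sup [set `|f x| | x in [set x : E | `|x| <= 1]].

Definition reflexive_space : Prop :=
  forall Phi : (E -> R) -> R,
    (forall (a : R) f g, is_dual f -> is_dual g ->
        Phi (fun x => a * f x + g x) = a * Phi f + Phi g) ->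
    (forall f0, is_dual f0 -> forall eps : R, 0 < eps ->
        exists2 delta : R, 0 < delta & forall f, is_dual f ->
          dnorm (fun x => f x - f0 x) < delta -> `|Phi f - Phi f0| < eps) ->
    exists x : E, forall f, is_dual f -> Phi f = f x.

Definition multifun := E -> (E -> R) -> Prop.

Definition graph (S : multifun) : set (E * (E -> R)) :=
  [set p | is_dual p.2 /\ S p.1 p.2].

Definition monotone_mf (S : multifun) : Prop :=
  forall p q, graph S p -> graph S q -> 0 <= p.2 (p.1 - q.1) - q.2 (p.1 - q.1).

Definition maximal_monotone (S : multifun) : Prop :=
  monotone_mf S /\
  forall x xs, is_dual xs ->
    (forall q, graph S q -> 0 <= xs (x - q.1) - q.2 (x - q.1)) ->
    graph S (x, xs).

Definition fitzpatrick (S : multifun) (x : E) (xs : E -> R) : \bar R :=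
  ereal_sup [set EFin (p.2 x + xs p.1 - p.2 p.1) | p in graph S].

Definition dom_fitz (S : multifun) : set (E * (E -> R)) :=
  [set p | is_dual p.2 /\ fitzpatrick S p.1 p.2 \is a fin_num].

Definition pi1_dom_fitz (S : multifun) : set E := fst @` dom_fitz S.

Definition cone_diff (A B : set E) : set E :=
  [set z | exists l : R, 0 < l /\ exists2 a, A a & exists2 b, B b & z = l *: (a - b)].

Definition closed_subspace (U : set E) : Prop :=
  closed U /\ U 0 /\ (forall u v, U u -> U v -> U (u + v)) /\
  (forall (a : R) u, U u -> U (a *: u)).

Definition mf_sum (S T : multifun) : multifun :=
  fun x f => exists y z, graph S (x, y) /\ graph T (x, z) /\ f = (fun e => y e + z e).

End Defs.

(* Main.v *)
(* Let (z, zs) be monotonically related to the graph of S + T.  Consider the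
   convex function
     phi_S (x, s) + phi_T (y, t) - <x, zs> - <z, s + t> + <z, zs>
       + |x - z|^2 / 2 + |s + t - zs|^2 / 2.
   It is nonnegative when x = y, because phi_S and phi_T dominate the duality
   pairing.  By Baire's theorem, the differences x - y of points with
   bounded data fill a neighbourhood of 0 in the subspace of the hypothesis, so
   for some L the function plus L |x - y| is nonnegative everywhere (exact
   penalty).  Perturbing x - y and the arguments of both squares gives a convex
   function that is finite everywhere, and Hahn-Banach together with
   reflexivity yields a linear minorant (a, u, - p) of it, with a, p in E^* and
   u in E.  Evaluated on the graphs of S and T, the minorant reads
     phi_S (z - u, zs - a - p) + phi_T (z - u, p) <= (zs - a) (z - u),
   so that both Fitzpatrick inequalities are equalities, i.e. zs - a - p is in
   S (z - u) and p is in T (z - u).  Being related to this point of S + T gives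
   a (u) >= 0, whereas the slack in the minorant gives
   a (u) + |a|^2 / 2 + |u|^2 / 2 <= 0; hence u = 0 and a = 0. *)
Require Import Defs.
From mathcomp Require Import all_boot all_order all_algebra.
From mathcomp Require Import all_classical all_reals all_analysis.
From mathcomp Require Import ring lra.
Set Implicit Arguments. Unset Strict Implicit. Unset Printing Implicit Defensive.
Import Order.TTheory GRing.Theory Num.Theory.
Import numFieldNormedType.Exports.
Local Open Scope classical_set_scope.
Local Open Scope ring_scope.

(** * Hahn-Banach: linear minorants of convex epigraphs *)

Section HahnBanach.
Variables (R : realType) (Y : lmodType R) (Y0 : set Y) (W : set (Y * R)).
Hypothesis Y00 : Y0 0.
Hypothesis Y0D : forall u v, Y0 u -> Y0 v -> Y0 (u + v).
Hypothesis Y0Z : forall (a : R) u, Y0 u -> Y0 (a *: u).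
Hypothesis WY0 : forall y c, W (y, c) -> Y0 y.
Hypothesis Wconv : forall (a b : R) y c y' c', 0 < a -> 0 < b -> a + b = 1 ->
  W (y, c) -> W (y', c') -> W (a *: y + b *: y', a * c + b * c').
Hypothesis W0 : forall c, W (0, c) -> 0 <= c.
Hypothesis Wdom : forall y, Y0 y -> exists c, W (y, c).

Let K0 : set (Y * R) :=
  [set p | exists t y c, [/\ 0 <= t, W (y, c) & p = (t *: y, t * c)]].

(** Convex cones over [Y0], nonnegative over the origin and stable under adding [K0]. Inclusion of
    [K0] is not a clause, since the empty set, as union of the empty chain, has to be good;
    stability allows [K0] to be adjoined to a maximal [K] afterwards. *)
Let good (K : set (Y * R)) : Prop :=
  [/\ forall y c, K (y, c) -> Y0 y,
      forall y c y' c', K (y, c) -> K (y', c') -> K (y + y', c + c'),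
      forall (t : R) y c, 0 < t -> K (y, c) -> K (t *: y, t * c),
      forall y c y' c', K (y, c) -> K0 (y', c') -> K (y + y', c + c') &
      forall c, K (0, c) -> 0 <= c].

Let K0_00 : K0 (0, 0).
Proof.
have [c Wc] := Wdom Y00.
by exists 0, 0, c; split; rewrite ?scale0r ?mul0r.
Qed.

Let K0D y c y' c' : K0 (y, c) -> K0 (y', c') -> K0 (y + y', c + c').
Proof.
move=> [t [u [d [t0 Wu [-> ->]]]]] [s [v [e [s0 Wv [-> ->]]]]].
have [t00|tn0] := eqVneq t 0.
  by exists s, v, e; split; rewrite ?t00 ?scale0r ?mul0r ?add0r.
have [s00|sn0] := eqVneq s 0.
  by exists t, u, d; split; rewrite ?s00 ?scale0r ?mul0r ?addr0.
have tp : 0 < t by rewrite lt_neqAle eq_sym tn0.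
have sp : 0 < s by rewrite lt_neqAle eq_sym sn0.
have ts : 0 < t + s by rewrite addr_gt0.
exists (t + s), ((t / (t + s)) *: u + (s / (t + s)) *: v),
  ((t / (t + s)) * d + (s / (t + s)) * e); split.
- exact: ltW.
- apply: Wconv => //; [exact: divr_gt0|exact: divr_gt0|].
  by rewrite -mulrDl divff // gt_eqF.
- congr pair.
    by rewrite scalerDr !scalerA ![_ * (_ / _)]mulrC !divfK // gt_eqF.
  by field; rewrite gt_eqF.
Qed.

Let K0_good : good K0.
Proof.
split.
- by move=> y c [t [u [d [_ /WY0 Wu [-> _]]]]]; apply: Y0Z.
- exact: K0D.
- move=> t y c t0 [s [u [d [s0 Wu [-> ->]]]]]; exists (t * s), u, d; split => //.
    by rewrite mulr_ge0 // ltW.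
  by rewrite scalerA mulrA.
- exact: K0D.
- move=> c [t [u [d [t0 Wu [/esym/eqP]]]]].
  rewrite scaler_eq0 => /orP[/eqP -> ->|/eqP u0 ->]; first by rewrite mul0r.
  by rewrite mulr_ge0 // W0 // -u0.
Qed.

(** By maximality under Zorn's lemma: if no (- y, d) with d < - c lies in [K], adjoining the ray
    through (y, c) still gives a good cone, so (y, c) lies in [K] already. *)
Let maximal_cone : exists K, [/\ good K, K (0, 0), K0 `<=` K &
  forall y c, Y0 y -> K (y, c) \/ exists2 d, d < - c & K (- y, d)].
Proof.
have chain (F : set (set (Y * R))) :
    F `<=` good -> total_on F subset -> good (\bigcup_(X in F) X).
  move=> Fg Ft.
  split.
  - by move=> y c [X FX Xy]; have [+ _ _ _ _] := Fg _ FX; apply; exact: Xy.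
  - move=> y c y' c' [X FX Xy] [X' FX' Xy'].
    have [sX|sX] := Ft _ _ FX FX'.
      by exists X' => //; have [_ + _ _ _] := Fg _ FX'; apply => //; exact: sX.
    by exists X => //; have [_ + _ _ _] := Fg _ FX; apply => //; exact: sX.
  - move=> t y c t0 [X FX Xy]; exists X => //.
    by have [_ _ + _ _] := Fg _ FX; apply.
  - move=> y c y' c' [X FX Xy] Ky'; exists X => //.
    by have [_ _ _ + _] := Fg _ FX; apply.
  - by move=> c [X FX Xy]; have [_ _ _ _ +] := Fg _ FX; apply.
have [K [Kg Kmax]] := Zorn_bigcup chain.
have [KY KD KZ KK K00] := Kg.
have {}Kmax B : good B -> K `<=` B -> B `<=` K.
  move=> Bg KB; apply: contrapT => BK; exact: (Kmax B).
have K0K : K0 `<=` K.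
  have gKU : good (K `|` K0).
    have [k1 k2 k3 k4 k5] := K0_good.
    split.
    - by move=> y c [/KY//|/k1].
    - move=> y c y' c' [Ky|Ky] [Ky'|Ky'].
      + by left; exact: KD.
      + by left; exact: KK.
      + by left; rewrite [y + y']addrC [c + c']addrC; exact: KK.
      + by right; exact: k2.
    - by move=> t y c t0 [Ky|Ky]; [left; exact: KZ|right; exact: k3].
    - by move=> y c y' c' [Ky|Ky] Ky'; [left; exact: KK|right; exact: k2].
    - by move=> c [/K00|/k5].
  by move=> x K0x; apply: (Kmax _ gKU); [move=> ? ?; left|right].
have K0' : K (0, 0) by apply: K0K.
exists K; split => // y c Yy.
have [|nK] := pselect (exists2 d, d < - c & K (- y, d)); first by right.
left.
pose K' : set (Y * R) := [set p | exists k d s,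
  [/\ K (k, d), 0 <= s & p = (k + s *: y, d + s * c)]].
have K'g : good K'.
  split.
  - move=> _ _ [k [d [s [Kk s0 [-> _]]]]].
    by apply: Y0D; [exact: KY Kk|exact: Y0Z].
  - move=> _ _ _ _ [k [d [s [Kk s0 [-> ->]]]]] [k' [d' [s' [Kk' s0' [-> ->]]]]].
    exists (k + k'), (d + d'), (s + s'); split; [exact: KD|exact: addr_ge0|].
    by rewrite scalerDl mulrDl addrACA [d + _ + _]addrACA.
  - move=> t _ _ t0 [k [d [s [Kk s0 [-> ->]]]]].
    exists (t *: k), (t * d), (t * s); split; [exact: KZ|by rewrite mulr_ge0 // ltW|].
    by rewrite scalerDr scalerA mulrDr mulrA.
  - move=> _ _ y' c' [k [d [s [Kk s0 [-> ->]]]]] Ky'.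
    exists (k + y'), (d + c'), s; split => //; first exact: KK.
    by rewrite addrAC [d + _ + _]addrAC.
  (* A negative height over 0 with s > 0 would, after division by s, put (- y, d / s) in [K] with d
     / s < - c, against [nK]. *)
  - move=> e [k [d [s [Kk s0 [/esym/eqP]]]]].
    rewrite addr_eq0 => /eqP kE ->.
    have [s00|sn0] := eqVneq s 0.
      rewrite s00 mul0r addr0; apply: K00.
      by move: Kk; rewrite kE s00 scale0r oppr0.
    have sp : 0 < s by rewrite lt_neqAle eq_sym sn0.
    rewrite leNgt; apply/negP => dneg; apply: nK.
    exists (s^-1 * d).
      have : s^-1 * (d + s * c) < 0 by rewrite pmulr_rlt0 // invr_gt0.
      by rewrite mulrDr mulKf //; lra.
    have /(KZ s^-1) : K (k, d) by [].
    by rewrite invr_gt0 kE scalerN scalerA mulVf // scale1r; apply.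
apply: (Kmax _ K'g).
  move=> [k d] Kk; exists k, d, 0; split => //.
  by rewrite scale0r mul0r !addr0.
by exists 0, 0, 1; split => //; rewrite scale1r mul1r !add0r.
Qed.

(** The infimum of the fibres of the maximal cone is sublinear, and the dichotomy of [maximal_cone]
    makes it odd; hence it is linear on [Y0]. *)
Lemma linear_minorant : exists l : Y -> R,
  (forall (a : R) u v, Y0 u -> Y0 v -> l (a *: u + v) = a * l u + l v) /\
  (forall y c, W (y, c) -> l y <= c).
Proof.
have [K [[KY KD KZ _ K00] K0' K0K Kd]] := maximal_cone.
have Y0N u : Y0 u -> Y0 (- u) by rewrite -scaleN1r; exact: Y0Z.
have dom u : Y0 u -> exists c, K (u, c).
  move=> /Wdom[c Wc]; exists c; apply: K0K; exists 1, u, c.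
  by rewrite scale1r mul1r.
pose l u := inf [set c | K (u, c)].
have lbd u : Y0 u -> has_lbound [set c | K (u, c)].
  move=> /Y0N/dom[d Kd']; exists (- d) => c /= Kc.
  by have := KD _ _ _ _ Kc Kd'; rewrite subrr => /K00; lra.
have l_le u c : K (u, c) -> l u <= c.
  by move=> Kc; apply: ge_inf => //; apply: lbd; exact: KY Kc.
have l_ge u x : Y0 u -> (forall c, K (u, c) -> x <= c) -> x <= l u.
  by move=> Yu xc; apply: lb_le_inf => //; exact: dom.
have lD u v : Y0 u -> Y0 v -> l (u + v) <= l u + l v.
  move=> Yu Yv; rewrite -lerBlDr; apply: (l_ge _ _ Yu) => c Kc.
  rewrite lerBlDr -lerBlDl; apply: l_ge => // d Kd'.
  by rewrite lerBlDl; apply: l_le; exact: KD.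
have lN u : Y0 u -> l (- u) = - l u.
  move=> Yu; apply/eqP; rewrite eq_le; apply/andP; split; last first.
    rewrite lerNl; apply: (l_ge _ _ Yu) => c Kc; rewrite lerNl; apply: l_ge => [|d Kd'].
      exact: Y0N.
    by have := KD _ _ _ _ Kc Kd'; rewrite subrr => /K00; lra.
  (* At height [l u - e] the first alternative would undercut the infimum; the second gives l (- u)
     < e - l u. *)
  apply/ler_addgt0Pr => e e0.
  have [/l_le|[d dl /l_le]] := Kd u (l u - e) Yu; lra.
have lZ t u : 0 < t -> Y0 u -> l (t *: u) <= t * l u.
  move=> t0 Yu; rewrite mulrC -ler_pdivrMr //; apply: l_ge => // c Kc.
  by rewrite ler_pdivrMr // mulrC; apply: l_le; exact: KZ.
have l0 : l 0 = 0.
  by apply/eqP; rewrite eq_le l_le //=; apply: l_ge.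
have lZ' t u : 0 < t -> Y0 u -> l (t *: u) = t * l u.
  move=> t0 Yu; apply/eqP; rewrite eq_le lZ //=.
  have := lZ t (- u) t0 (Y0N _ Yu); rewrite scalerN !lN //; last exact: Y0Z.
  by rewrite mulrN lerN2.
have lZr t u : Y0 u -> l (t *: u) = t * l u.
  move=> Yu; have [tp|tn|->] := ltgtP t 0; last by rewrite scale0r l0 mul0r.
    rewrite -[t]opprK scaleNr lN; last exact: Y0Z.
    by rewrite lZ' ?oppr_gt0 // !mulNr.
  exact: lZ'.
have lD' u v : Y0 u -> Y0 v -> l (u + v) = l u + l v.
  move=> Yu Yv; apply/eqP; rewrite eq_le lD //=.
  by have := lD _ _ (Y0N _ Yu) (Y0N _ Yv); rewrite -opprD !lN //; [lra|exact: Y0D].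
exists l; split => [a u v Yu Yv|y c Wy]; first by rewrite lD' ?lZr//; exact: Y0Z.
by apply: l_le; apply: K0K; exists 1, y, c; rewrite scale1r mul1r.
Qed.

End HahnBanach.

(** * Infinite convex combinations with dyadic weights *)

Section DyadicAverages.
Variable R : realType.

(** Partial sums of the convex combination with weights 1/2, 1/4, and so on; the first [n] weights
    add up to 1 - 2^-n. *)
Definition dyadic_sum (V : normedModType R) (c : nat -> V) (n : nat) : V :=
  \sum_(i < n) 2^-1 ^+ i.+1 *: c i.

Lemma dyadic_sumS (V : normedModType R) (c : nat -> V) n :
  dyadic_sum c n.+1 = dyadic_sum c n + 2^-1 ^+ n.+1 *: c n.
Proof. by rewrite /dyadic_sum big_ord_recr. Qed.

Lemma geometric_cvg (V : completeNormedModType R) (u : nat -> V) (K : R) :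
  (forall n, `|u n.+1 - u n| <= K * 2^-1 ^+ n) -> cvgn u.
Proof.
move=> uK.
have sc : cvgn (series (telescope u)).
  apply: normed_cvg.
  apply: (@series_le_cvg _ _ (geometric K 2^-1)) => //.
  - by move=> n; exact: normr_ge0.
  - by move=> n; exact: le_trans (normr_ge0 _) (uK n).
  - by apply: is_cvg_geometric_series; rewrite ger0_norm ?invr_ge0//; lra.
have -> : u = (fun n => u 0%N + series (telescope u) n).
  by apply/funext => n; exact: eq_sum_telescope.
by apply: is_cvgD => //; exact: is_cvg_cst.
Qed.

Lemma dyadic_sum_cvg (V : completeNormedModType R) (c : nat -> V) (K : R) :
  (forall i, `|c i| <= K) -> cvgn (dyadic_sum c).
Proof.
move=> cK; apply: (@geometric_cvg _ _ K) => n.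
rewrite dyadic_sumS addrAC subrr add0r normrZ ger0_norm ?exprn_ge0 ?invr_ge0//.
rewrite mulrC ler_pM ?exprn_ge0 ?invr_ge0//.
by rewrite exprS ler_piMl ?exprn_ge0 ?invr_ge0//; lra.
Qed.

(** The total weight stays in the bound because [K] may be negative; it disappears only in the
    limit. *)
Lemma dyadic_sum_le (r : nat -> R) (K : R) n :
  (forall i, r i <= K) -> dyadic_sum r n <= K * (1 - 2^-1 ^+ n).
Proof.
move=> rK; elim: n => [|n IH].
  by rewrite /dyadic_sum big_ord0 expr0 subrr mulr0.
rewrite dyadic_sumS; apply: (le_trans (lerD IH _)).
  apply: (ler_wpM2l _ (rK n)); by rewrite exprn_ge0// invr_ge0.
rewrite exprS; set p := 2^-1 ^+ n; lra.
Qed.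

Lemma lim_dyadic_sum_le (r : nat -> R) (K l : R) :
  (forall i, r i <= K) -> dyadic_sum r x @[x --> \oo] --> l -> l <= K.
Proof.
move=> rK rl.
have Kl : (fun n : nat => K - geometric K 2^-1 n) x @[x --> \oo] --> K - 0.
  apply: cvgB; first exact: cvg_cst.
  by apply: cvg_geometric; rewrite ger0_norm ?invr_ge0//; lra.
rewrite -[K]subr0; apply: (ler_cvg_to rl Kl); apply: nearW => n /=.
by have := dyadic_sum_le n rK; rewrite mulrBr mulr1.
Qed.

Lemma dyadic_sum_norm_le (V : normedModType R) (c : nat -> V) (K : R) n :
  (forall i, `|c i| <= K) -> `|dyadic_sum c n| <= K.
Proof.
move=> cK; have K0 : 0 <= K by apply: le_trans (cK 0%N).
have H : `|dyadic_sum c n| <= dyadic_sum (fun i => `|c i|) n.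
  elim: n => [|n IH]; first by rewrite /dyadic_sum !big_ord0 normr0.
  rewrite !dyadic_sumS; apply: (le_trans (ler_normD _ _)).
  rewrite lerD // normrZ ger0_norm ?exprn_ge0 ?invr_ge0//.
apply: (le_trans H); apply: (le_trans (dyadic_sum_le n cK)).
by rewrite ler_piMr // lerBlDr lerDl exprn_ge0 // invr_ge0.
Qed.

End DyadicAverages.

(** * Baire's theorem on a closed set, and ideally convex sets *)

Section Lifshits.
Variables (R : realType) (E : completeNormedModType R).

(** Otherwise there are shrinking closed balls centred in [M], each avoiding one more [F n]; the
    centres converge to a point of [M] outside every [F n]. *)
Lemma baire_closed (M : set E) (F : nat -> set E) (x0 : E) :
  closed M -> M x0 -> (forall n, closed (F n)) ->
  (forall x, M x -> exists n, F n x) ->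
  exists n x r, [/\ M x, 0 < r & forall y, M y -> `|y - x| < r -> F n y].
Proof.
move=> cM Mx0 cF cov; apply: contrapT => nF.
(* The conditions on the current ball stand inside the existential, so that [choice] yields a total
   function; where they fail, the ball itself is a dummy value. *)
have step (ns : nat * (E * R)) : exists t : E * R,
    M ns.2.1 -> 0 < ns.2.2 -> [/\ M t.1, 0 < t.2, t.2 <= ns.2.2 / 2,
    `|t.1 - ns.2.1| <= ns.2.2 / 2 & forall w, `|w - t.1| <= t.2 -> ~ F ns.1 w].
  case: ns => n [x r] /=.
  have [[Mx r0]|nMr] := pselect (M x /\ 0 < r); last first.
    by exists (x, r) => Mx r0; exfalso; apply: nMr.
  have [y [My yx nFy]] : exists y, [/\ M y, `|y - x| < r / 2 & ~ F n y].
    apply: contrapT => H; apply: nF; exists n, x, (r / 2); split => //.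
      by rewrite divr_gt0.
    by move=> y My yx; apply: contrapT => nFy; apply: H; exists y.
  have /nbhs_ballP[d /= d0 dF] : nbhs y (~` F n).
    by apply: open_nbhs_nbhs; split => //; exact: closed_openC.
  (* Half of [d] keeps the closed ball off [F n]; half of [r] makes the radii decay
     geometrically. *)
  exists (y, Num.min (d / 2) (r / 2)) => _ _ /=; split => //.
  - by rewrite lt_min !divr_gt0.
  - by rewrite ge_min lexx orbT.
  - exact: ltW.
  - move=> w wy; apply: dF; rewrite -ball_normE /= distrC.
    by apply: (le_lt_trans wy); rewrite gt_min ltr_pdivrMr // ltr_pMr //; lra.
have [f fP] := choice step.
pose u := fix u n : E * R := if n is m.+1 then f (m, u m) else (x0, 1).
have uP n : M (u n).1 /\ 0 < (u n).2.
  by elim: n => [|n [IH1 IH2]] //=; have [] := fP (n, u n) IH1 IH2.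
have uS n := fP (n, u n) (uP n).1 (uP n).2.
have rS n : (u n.+1).2 <= (u n).2 / 2 by have [] := uS n.
have xS n : `|(u n.+1).1 - (u n).1| <= (u n).2 / 2 by have [] := uS n.
have rn n : (u n).2 <= 2^-1 ^+ n.
  elim: n => [|n IH]; first by rewrite expr0.
  by apply: (le_trans (rS n)); rewrite exprSr ler_pM2r // invr_gt0.
have cu : cvgn (fun n => (u n).1).
  apply: (@geometric_cvg _ _ _ (2^-1)) => n.
  apply: (le_trans (xS n)); rewrite mulrC ler_pM2l ?rn // invr_gt0//.
set x := limn (fun n => (u n).1) in cu.
have Mx : M x.
  by apply: (closed_cvg M cM _ _ cu); apply: nearW => n; exact: (uP n).1.
have [n Fx] := cov x Mx.
have [_ _ _ _ /(_ x)] := uS n; apply => //.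
(* The centre never moves by more than the radius drops, so the limit stays in every closed ball. *)
have close m : `|(u (n.+1 + m)%N).1 - (u n.+1).1| <= (u n.+1).2 - (u (n.+1 + m)%N).2.
  elim: m => [|m IH]; first by rewrite addn0 subrr normr0 subrr.
  rewrite addnS; apply: (le_trans (ler_distD (u (n.+1 + m)%N).1 _ _)).
  have := rS (n.+1 + m)%N; have := xS (n.+1 + m)%N; lra.
have cx : `|(u (m + n.+1)%N).1 - (u n.+1).1| @[m --> \oo] --> `|x - (u n.+1).1|.
  apply: cvg_norm; apply: cvgB; last exact: cvg_cst.
  by rewrite (cvg_shiftn n.+1 (fun k => (u k).1)).
apply: (cvgr_to_le cx); apply: nearW => m; rewrite addnC.
by apply: (le_trans (close m)); rewrite gerBl ltW // (uP _).2.
Qed.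

(* Lifshits' theorem on ideally convex sets; the dyadic averages are the only
   infinite convex combinations that the successive approximation of [v] needs. *)
Lemma ideally_convex_nbhs0 (M C : set E) :
  closed_subspace M ->
  (forall v, C v -> M v) ->
  (forall (a b : R) u v, 0 <= a -> 0 <= b -> a + b = 1 -> C u -> C v ->
    C (a *: u + b *: v)) ->
  (forall c v, (forall i, C (c i)) -> dyadic_sum c n @[n --> \oo] --> v -> C v) ->
  (forall m, M m -> exists2 t : R, 0 < t & C (t *: m)) ->
  exists2 r : R, 0 < r & forall v, M v -> `|v| < r -> C v.
Proof.
move=> [cM [M0 [MD MZ]]] CM Cconv Cic Cabs.
have C0 : C 0 by have [t _] := Cabs _ M0; rewrite scaler0.
have Cshrink (a : R) v : 0 <= a -> a <= 1 -> C v -> C (a *: v).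
  move=> a0 a1 Cv; rewrite -[a *: v]addr0 -(scaler0 _ (1 - a)).
  by apply: Cconv => //; lra.
(* [F n] is the closure of (n + 1) C; these sets cover [M] because [C] is absorbing and star-shaped
   about 0. *)
pose F (n : nat) : set E := closure [set v | C (n.+1%:R^-1 *: v)].
have [|n [x [e [Mx e0 Fx]]]] :=
    baire_closed cM M0 (fun n => @closed_closure _ [set v | C (n.+1%:R^-1 *: v)]).
  move=> m Mm; have [t t0 Ct] := Cabs m Mm.
  have [n tn] : exists n : nat, t^-1 < n.+1%:R.
    have := archi_boundP (ltW (_ : 0 < t^-1)); rewrite invr_gt0 => /(_ t0) H.
    by exists (Num.Def.archi_bound t^-1); apply: (lt_trans H); rewrite ltr_nat.
  exists n; apply: subset_closure => /=.
  have -> : n.+1%:R^-1 *: m = (n.+1%:R^-1 / t) *: (t *: m).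
    by rewrite scalerA divfK // gt_eqF.
  apply: Cshrink => //; first by rewrite divr_ge0 // ltW.
  by rewrite ler_pdivrMl ?ltr0n // mulr1 ltW.
have [s s0 Cs] := Cabs _ (MZ (-1) _ Mx).
pose N : R := n.+1%:R; have N0 : 0 < N by rewrite ltr0n.
pose K := N + s^-1; have K0 : 0 < K by rewrite addr_gt0 // invr_gt0.
(* convexity moves the ball around [x] to a ball around [0] *)
have dense v : M v -> `|v| < e / K -> forall d, 0 < d -> exists2 c, C c & `|v - c| < d.
  move=> Mv ve d d0.
  have MKv : M (x + K *: v) by apply: MD => //; exact: MZ.
  have : closure [set v | C (N^-1 *: v)] (x + K *: v).
    apply: Fx => //; rewrite addrAC subrr add0r normrZ gtr0_norm //.
    by rewrite mulrC -ltr_pdivlMr.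
  have Kd : 0 < K * d by rewrite mulr_gt0.
  move=> /(_ _ (nbhsx_ballx (x + K *: v) (K * d) Kd))[w [/= Cw]].
  rewrite -ball_normE /= => wv.
  exists (K^-1 *: (w - x)).
    have -> : K^-1 *: (w - x) = (N / K) *: (N^-1 *: w) + (s^-1 / K) *: (s *: (-1 *: x)).
      rewrite !scalerA scalerBr -scaleNr; congr (_ *: _ + _ *: _).
        by field; rewrite !gt_eqF.
      by field; rewrite !gt_eqF.
    apply: Cconv => //; try by rewrite divr_ge0 // ltW // invr_gt0.
    by rewrite -mulrDl divff // gt_eqF.
  have -> : v - K^-1 *: (w - x) = K^-1 *: (x + K *: v - w).
    rewrite !(scalerBr, scalerDr) scalerA mulVf ?gt_eqF // scale1r.
    by rewrite opprB addrA [v + _]addrC.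
  by rewrite normrZ gtr0_norm ?invr_gt0 // ltr_pdivrMl.
(* Half the radius within which [C] is dense, so that 2 w is still in range when |w| < r. *)
pose r := e / K / 2.
have r0 : 0 < r by rewrite !divr_gt0.
exists r => // v Mv vr.
have step (w : E) : exists c, M w -> `|w| < r -> C c /\ `|2 *: w - c| < r.
  have [[Mw wr]|H] := pselect (M w /\ `|w| < r); last first.
    by exists 0 => Mw wr; exfalso; exact: H.
  have [||c Cc wc] := dense (2 *: w) _ _ r r0.
  - exact: MZ.
  - by rewrite normrZ ger0_norm // mulrC -ltr_pdivlMr.
  by exists c.
have [g gP] := choice step.
(* [w k] is 2^k times the error left after k terms; a point of [C] within [r] of 2 w keeps the next
   one below [r]. *)
pose w := fix w n : E := if n is m.+1 then 2 *: w m - g (w m) else v.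
have wP k : M (w k) /\ `|w k| < r.
  elim: k => [|k [IH1 IH2]] //=.
  have [Cg gr] := gP _ IH1 IH2; split => //.
  by apply: MD; [exact: MZ|rewrite -scaleN1r; apply: MZ; exact: CM].
apply: (Cic (fun i => g (w i))).
  by move=> i; have [M1 M2] := wP i; have [] := gP _ M1 M2.
have vE k : dyadic_sum (fun i => g (w i)) k = v - 2^-1 ^+ k *: w k.
  elim: k => [|k IH].
    by rewrite /dyadic_sum big_ord0 expr0 scale1r subrr.
  rewrite dyadic_sumS IH /= scalerBr scalerA opprB -addrA; congr (_ + _).
  by rewrite exprSr -mulrA mulVf // mulr1 addrC.
rewrite (_ : dyadic_sum _ = (fun k => v - 2^-1 ^+ k *: w k)); last exact/funext.
rewrite -[X in _ --> X]subr0; apply: cvgB; first exact: cvg_cst.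
apply/cvgr0Pnorm_le => d d0.
have /cvgr0Pnorm_le/(_ d d0) : geometric r 2^-1 k @[k --> \oo] --> (0 : R).
  by apply: cvg_geometric; rewrite ger0_norm ?invr_ge0//; lra.
apply: filterS => k /=; apply: le_trans.
rewrite normrZ normrM [X in _ <= X]mulrC; apply: ler_pM => //.
by rewrite (ltW (lt_le_trans (wP k).2 _)) // ler_norm.
Qed.

End Lifshits.

(** * Bounded linear functionals *)

Section Duals.
Variables (R : realType) (E : normedModType R).
Implicit Types f g : E -> R.

(** Any upper bound for the operator norm, so that convexity arguments can carry [k] along as a
    plain number. *)
Definition op_bound (k : R) f := forall v, `|f v| <= k * `|v|.

Lemma dualD f u v : is_dual f -> f (u + v) = f u + f v.
Proof. by move=> [lf _]; rewrite -[u]scale1r lf mul1r scale1r. Qed.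

Lemma dual0 f : is_dual f -> f 0 = 0.
Proof. by move=> df; have := dualD 0 0 df; rewrite addr0; lra. Qed.

Lemma dualZ f a u : is_dual f -> f (a *: u) = a * f u.
Proof. by move=> df; rewrite -[a *: u]addr0 (proj1 df) dual0 // addr0. Qed.

Lemma dualN f u : is_dual f -> f (- u) = - f u.
Proof. by move=> df; rewrite -scaleN1r dualZ // mulN1r. Qed.

Lemma dualB f u v : is_dual f -> f (u - v) = f u - f v.
Proof. by move=> df; rewrite dualD // dualN. Qed.

Lemma dual_bounded f : is_dual f -> exists2 k, 0 < k & op_bound k f.
Proof.
move=> df; have f0 : f x @[x --> (0 : E)] --> (0 : R).
  by rewrite -[X in _ --> X](dual0 df); exact: (proj2 df).
have /nbhs_ballP[d /= d0 dB] : \forall x \near (0 : E), `|f x| < 1.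
  by apply: cvgr0_norm_lt; [exact: f0|exact: ltr01].
exists (2 / d) => [|v]; first by rewrite divr_gt0.
have [->|v0] := eqVneq v 0; first by rewrite dual0 // !normr0 mulr0.
have nv : 0 < `|v| by rewrite normr_gt0.
have /ltW : `|f ((d / 2 / `|v|) *: v)| < 1.
  apply: dB; rewrite -ball_normE /= sub0r normrN normrZ ger0_norm.
    by rewrite divfK ?gt_eqF //; lra.
  by rewrite !divr_ge0 // ltW.
rewrite dualZ // normrM ger0_norm; last by rewrite !divr_ge0 // ltW.
rewrite -ler_pdivlMl ?divr_gt0 // mulr1; congr (_ <= _).
by field; rewrite !gt_eqF.
Qed.

Lemma bounded_dual f k :
  (forall (a : R) u v, f (a *: u + v) = a * f u + f v) -> op_bound k f ->
  is_dual f.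
Proof.
move=> lf bf; split => // x.
apply/cvgrPdist_le => e e0.
have k0 : 0 < `|k| + 1 by apply: ltr_pwDr.
near=> y.
have -> : f x - f y = f (x - y).
  by rewrite (addrC x) -(scaleN1r y) lf mulN1r addrC.
apply: (le_trans (bf _)).
have xy : `|x - y| <= e / (`|k| + 1).
  near: y; apply: cvgr_dist_le; first exact: cvg_id.
  by rewrite divr_gt0.
move: xy; rewrite ler_pdivlMr // mulrC; apply: le_trans.
by apply: ler_wpM2r => //; have := ler_norm k; lra.
Unshelve. all: by end_near. Qed.

(** A one-sided bound suffices: at - v it bounds [f] from below, and homogeneity carries it beyond
    the ball. *)
Lemma dual_of_unit_bound (f : E -> R) (B : R) :
  (forall (a : R) u v, f (a *: u + v) = a * f u + f v) ->
  (forall v, `|v| <= 1 -> f v <= B) -> is_dual f.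
Proof.
move=> lf fB.
have f0 : f 0 = 0 by have := lf 1 0 0; rewrite scaler0 addr0; lra.
have fZ a v : f (a *: v) = a * f v by rewrite -[_ *: v]addr0 lf f0 addr0.
have le v : f v <= B * `|v|.
  have [->|v0] := eqVneq v 0; first by rewrite f0 normr0 mulr0.
  have nv : 0 < `|v| by rewrite normr_gt0.
  have := fB (`|v|^-1 *: v); rewrite fZ normrZ normfV normr_id mulVf ?gt_eqF //.
  by move=> /(_ (lexx _)); rewrite ler_pdivrMl // mulrC.
apply: (bounded_dual lf (k := B)) => v; rewrite ler_norml le andbT lerNl.
by rewrite -mulN1r -fZ scaleN1r -[`|v|]normrN.
Qed.

Lemma dual_comb f g (a b : R) : is_dual f -> is_dual g ->
  is_dual (fun v => a * f v + b * g v).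
Proof.
move=> df dg; have [k k0 fk] := dual_bounded df; have [l l0 gl] := dual_bounded dg.
apply: (@bounded_dual _ (`|a| * k + `|b| * l)) => [c u v|v].
  by rewrite (proj1 df) (proj1 dg); ring.
apply: (le_trans (ler_normD _ _)); rewrite !normrM mulrDl -!mulrA.
by apply: lerD; apply: ler_wpM2l.
Qed.

Lemma dual_zero : is_dual (fun _ : E => 0 : R).
Proof.
apply: (@bounded_dual _ 0) => [c u v|v]; first by rewrite mulr0 addr0.
by rewrite normr0 mul0r.
Qed.

Lemma op_bound_comb f g (a b k l : R) : op_bound k f -> op_bound l g ->
  op_bound (`|a| * k + `|b| * l) (fun v => a * f v + b * g v).
Proof.
move=> fk gl v; apply: (le_trans (ler_normD _ _)); rewrite !normrM mulrDl -!mulrA.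
by apply: lerD; apply: ler_wpM2l.
Qed.

Lemma dnorm_op_bound f : is_dual f -> op_bound (dnorm f) f.
Proof.
move=> df v; have [k k0 fk] := dual_bounded df.
have [->|v0] := eqVneq v 0; first by rewrite dual0 // !normr0 mulr0.
have nv : 0 < `|v| by rewrite normr_gt0.
rewrite -ler_pdivrMr //.
have -> : `|f v| / `|v| = `|f (`|v|^-1 *: v)|.
  by rewrite dualZ // normrM normfV normr_id mulrC.
apply: ub_le_sup.
  exists k => _ [x /= x1 <-]; apply: (le_trans (fk x)).
  by rewrite ler_piMr // ltW.
exists (`|v|^-1 *: v) => //=.
by rewrite normrZ normfV normr_id mulVf // gt_eqF.
Qed.

(* [f] is a linear minorant of [y |-> inf_tau (|u| |y + tau u| - tau |u|^2)]. *)
Lemma norming_functional (u : E) :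
  exists f, [/\ is_dual f, op_bound `|u| f & f u = `|u| ^+ 2].
Proof.
pose W : set (E * R) :=
  [set p | exists tau : R, `|u| * `|p.1 + tau *: u| - tau * `|u| ^+ 2 <= p.2].
have [|||||||l [lin lW]] := @linear_minorant R E setT W => //.
- move=> a b y c y' c' a0 b0 ab [t /= tc] [t' /= tc'].
  exists (a * t + b * t') => /=.
  have -> : a *: y + b *: y' + (a * t + b * t') *: u =
      a *: (y + t *: u) + b *: (y' + t' *: u).
    by rewrite scalerDl !scalerDr !scalerA addrACA.
  apply: (@le_trans _ _ (a * (`|u| * `|y + t *: u| - t * `|u| ^+ 2) +
     b * (`|u| * `|y' + t' *: u| - t' * `|u| ^+ 2))); last first.
    by apply: lerD; rewrite ler_pM2l.
  have : `|a *: (y + t *: u) + b *: (y' + t' *: u)| <=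
      a * `|y + t *: u| + b * `|y' + t' *: u|.
    by apply: (le_trans (ler_normD _ _)); rewrite !normrZ !gtr0_norm.
  move=> /(ler_wpM2l (normr_ge0 u)); rewrite !mulrDr !mulrDl; lra.
- move=> c [t /=]; rewrite add0r normrZ; apply: le_trans.
  by rewrite mulrCA -expr2 subr_ge0 ler_wpM2r ?sqr_ge0 // ler_norm.
- by move=> y _; exists (`|u| * `|y + 0 *: u| - 0 * `|u| ^+ 2), 0.
have lin' (a : R) v w : l (a *: v + w) = a * l v + l w by exact: lin.
have l_le v : l v <= `|u| * `|v|.
  by apply: lW; exists 0 => /=; rewrite scale0r addr0 mul0r subr0.
have l0 : l 0 = 0 by have := lin' 1 0 0; rewrite scaler0 addr0; lra.
have lN v : l (- v) = - l v by rewrite -scaleN1r -[_ *: v]addr0 lin' l0; lra.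
have bl : op_bound `|u| l.
  by move=> v; rewrite ler_norml l_le andbT lerNl -lN -[`|v|]normrN.
exists l; split => //; first exact: bounded_dual bl.
apply/eqP; rewrite eq_le; apply/andP; split; first by rewrite expr2.
(* With tau = 1 the norm term vanishes at - u. *)
have : l (- u) <= - `|u| ^+ 2.
  by apply: lW; exists 1 => /=; rewrite scale1r addNr normr0 mulr0; lra.
by rewrite lN; lra.
Qed.

End Duals.

(** * Fitzpatrick functions of maximally monotone operators *)

Section Fitzpatrick.
Variables (R : realType) (E : normedModType R) (S : multifun E).

(** The epigraph of phi_S as one inequality per graph point, each affine in (x, xs), which stays
    within the real numbers. *)
Definition fitz_le (x : E) (xs : E -> R) (c : R) :=
  forall q, graph S q -> q.2 x + xs q.1 - q.2 q.1 <= c.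

Lemma fitz_le_mono x xs c c' : c <= c' -> fitz_le x xs c -> fitz_le x xs c'.
Proof. by move=> cc' H q /H; move: cc'; lra. Qed.

Lemma fitz_le_comb x xs c y ys d (a b : R) : 0 <= a -> 0 <= b -> a + b = 1 ->
  fitz_le x xs c -> fitz_le y ys d ->
  fitz_le (a *: x + b *: y) (fun v => a * xs v + b * ys v) (a * c + b * d).
Proof.
move=> a0 b0 ab Hx Hy q Sq; have [dq _] := Sq.
rewrite (dualD _ _ dq) !(dualZ _ _ dq) /=.
have := ler_wpM2l a0 (Hx _ Sq); have := ler_wpM2l b0 (Hy _ Sq).
have : q.2 q.1 = a * q.2 q.1 + b * q.2 q.1 by rewrite -mulrDl ab mul1r.
rewrite !(mulrDr, mulrBr); lra.
Qed.

Lemma dom_fitz_le x : pi1_dom_fitz S x -> exists xs c, is_dual xs /\ fitz_le x xs c.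
Proof.
move=> [[y xs] [dxs fin] <-] /=; exists xs, (fine (fitzpatrick S y xs)); split => //.
move=> q Sq; rewrite -lee_fin fineK //.
by apply: ereal_sup_ubound; exists q.
Qed.

Hypothesis maxS : maximal_monotone S.

Lemma fitz_le_graph q : graph S q -> fitz_le q.1 q.2 (q.2 q.1).
Proof.
move=> Sq p Sp; have := (proj1 maxS) _ _ Sq Sp.
by rewrite (dualB _ _ (proj1 Sp)) (dualB _ _ (proj1 Sq)); lra.
Qed.

(** Rearranged, phi_S (x, xs) <= <x, xs> says that (x, xs) is monotonically related to the graph. *)
Lemma graph_fitz_le x xs : is_dual xs -> fitz_le x xs (xs x) -> graph S (x, xs).
Proof.
move=> dxs H; apply: (proj2 maxS) => // q Sq; have := H _ Sq.
by rewrite (dualB _ _ dxs) (dualB _ _ (proj1 Sq)); lra.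
Qed.

(** A value below the pairing would put (x, xs) in the graph, where its own term of the supremum
    equals the pairing. *)
Lemma fitz_le_pairing x xs c : is_dual xs -> fitz_le x xs c -> xs x <= c.
Proof.
move=> dxs H; rewrite leNgt; apply/negP => cx.
have /(H _)/= : graph S (x, xs).
  by apply: graph_fitz_le => //; apply: fitz_le_mono H; exact: ltW.
by lra.
Qed.

Lemma fitz_le_dom x xs c : is_dual xs -> fitz_le x xs c -> pi1_dom_fitz S x.
Proof.
move=> dxs H.
(* An empty graph would have (0, 0) vacuously related to it, against maximality. A graph point
   excludes the value -oo. *)
have [q Sq] : exists q, graph S q.
  apply: contrapT => nS; apply: (nS); exists (0, fun _ => 0).
  apply: (proj2 maxS) => [|q Sq]; first exact: dual_zero.
  by exfalso; apply: nS; exists q.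
exists (x, xs) => //; split => //=.
rewrite fin_numElt; apply/andP; split.
  apply: (@lt_le_trans _ _ (q.2 x + xs q.1 - q.2 q.1)%:E); first exact: ltNyr.
  by apply: ereal_sup_ubound; exists q.
apply: (@le_lt_trans _ _ c%:E); last exact: ltry.
by apply: ge_ereal_sup => _ [p Sp <-]; rewrite lee_fin; exact: H.
Qed.

(** One number bounds the value, the point and the functional; the norm bounds make dyadic averages
    converge. *)
Definition fitz_level (n : R) (x : E) (xs : E -> R) :=
  [/\ is_dual xs, fitz_le x xs n, `|x| <= n & op_bound n xs].

Lemma fitz_level_mono n n' x xs : n <= n' -> fitz_level n x xs -> fitz_level n' x xs.
Proof.
move=> nn' [d f xn sn]; split => //; first exact: fitz_le_mono f.
- exact: le_trans nn'.
- by move=> v; apply: (le_trans (sn v)); apply: ler_wpM2r.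
Qed.

Lemma fitz_level_ex x xs c : is_dual xs -> fitz_le x xs c ->
  exists2 n, 0 <= n & fitz_level n x xs.
Proof.
move=> dxs H; have [k k0 kb] := dual_bounded dxs.
exists (`|c| + `|x| + k); first by rewrite !addr_ge0 // ltW.
have := ler_norm c; have := normr_ge0 x; have := normr_ge0 c => c0 x0 cc.
split => //; [|lra|].
- by apply: fitz_le_mono H; lra.
- by move=> v; apply: (le_trans (kb v)); apply: ler_wpM2r => //; lra.
Qed.

Lemma fitz_level_comb n x xs m y ys (a b : R) : 0 <= a -> 0 <= b -> a + b = 1 ->
  fitz_level n x xs -> fitz_level m y ys ->
  fitz_level (a * n + b * m) (a *: x + b *: y) (fun v => a * xs v + b * ys v).
Proof.
move=> a0 b0 ab [dx fx nx ox] [dy fy ny oy]; split.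
- exact: dual_comb.
- exact: fitz_le_comb.
- apply: (le_trans (ler_normD _ _)); rewrite !normrZ !ger0_norm //.
  by apply: lerD; apply: ler_wpM2l.
- by have := op_bound_comb a b ox oy; rewrite !ger0_norm.
Qed.

End Fitzpatrick.

(** * Stability of the levels under dyadic averages *)

Section Levels.
Variables (R : realType) (E : completeNormedModType R) (S : multifun E).

Lemma dual_dyadic_sum (f : E -> R) (c : nat -> E) n : is_dual f ->
  f (dyadic_sum c n) = dyadic_sum (fun i => f (c i)) n.
Proof.
move=> df; elim: n => [|n IH]; first by rewrite /dyadic_sum !big_ord0 dual0.
by rewrite !dyadic_sumS (dualD _ _ df) (dualZ _ _ df) IH.
Qed.

Lemma cvg_norm_le (V : normedModType R) (u : nat -> V) (x : V) (K : R) :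
  (forall n, `|u n| <= K) -> u n @[n --> \oo] --> x -> `|x| <= K.
Proof.
move=> uK ux; apply: (cvgr_to_le (cvg_norm ux)); exact: nearW.
Qed.

(** The functionals are averaged pointwise, and the common bound [n] keeps the limit in the dual.
    For a fixed graph point the inequality of [fitz_le] is affine and passes to the limit. *)
Lemma fitz_level_dyadic n (X : nat -> E) (Xs : nat -> E -> R) :
  (forall i, fitz_level S n (X i) (Xs i)) ->
  exists x xs, dyadic_sum X i @[i --> \oo] --> x /\ fitz_level S n x xs.
Proof.
move=> H.
have cX : cvgn (dyadic_sum X).
  by apply: (@dyadic_sum_cvg _ _ _ n) => i; have [] := H i.
have Xsv i v : `|Xs i v| <= n * `|v| by have [_ _ _] := H i; apply.
have cXs v : cvgn (dyadic_sum (fun i => Xs i v)) by apply: dyadic_sum_cvg (Xsv^~ v).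
pose xs v := limn (dyadic_sum (fun i => Xs i v)).
pose x := limn (dyadic_sum X).
have cx : dyadic_sum X i @[i --> \oo] --> x by [].
have cxs v : dyadic_sum (fun i => Xs i v) i @[i --> \oo] --> xs v by exact: cXs.
have bxs : op_bound n xs.
  move=> v; apply: cvg_norm_le (cxs v) => i.
  exact: dyadic_sum_norm_le (Xsv^~ v).
have lxs (a : R) u v : xs (a *: u + v) = a * xs u + xs v.
  have ca : (fun i => a * dyadic_sum (fun i => Xs i u) i + dyadic_sum (fun i => Xs i v) i)
      @ \oo --> a * xs u + xs v.
    by apply: cvgD => //; apply: cvgM => //; exact: cvg_cst.
  apply: (@cvg_unique _ (@Rhausdorff R) _ _ _ _ (cxs _)).
  rewrite (_ : dyadic_sum _ = (fun i => a * dyadic_sum (fun i => Xs i u) i +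
    dyadic_sum (fun i => Xs i v) i)) //.
  apply/funext => k; elim: k => [|k IH].
    by rewrite /dyadic_sum !big_ord0 mulr0 addr0.
  rewrite !dyadic_sumS IH; have [dk _ _ _] := H k.
  by rewrite (proj1 dk) /GRing.scale /=; ring.
exists x, xs; split => //; split => //.
- exact: bounded_dual bxs.
- move=> q Sq; have [dq _] := Sq; rewrite lerBlDr.
  have cq : (fun i => dyadic_sum (fun i => q.2 (X i) + Xs i q.1) i) @ \oo --> q.2 x + xs q.1.
    rewrite (_ : (fun i => _) = (fun i => q.2 (dyadic_sum X i) + dyadic_sum (fun i => Xs i q.1) i)).
      apply: cvgD => //; apply: (continuous_cvg _ _ cx); exact: (proj2 dq).
    apply/funext => k; rewrite dual_dyadic_sum //; elim: k => [|k IH].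
      by rewrite /dyadic_sum !big_ord0 addr0.
    by rewrite !dyadic_sumS IH /GRing.scale /=; ring.
  apply: (lim_dyadic_sum_le _ cq) => i; have [_ /(_ _ Sq) + _ _] := H i.
  by rewrite lerBlDr.
- apply: (cvg_norm_le _ cx) => k; apply: dyadic_sum_norm_le => i.
  by have [] := H i.
Qed.

End Levels.

(** * Differences of levels fill a neighbourhood of 0 in the subspace *)

Section LevelDifferences.
Variables (R : realType) (E : completeNormedModType R) (S T : multifun E).
Hypotheses (maxS : maximal_monotone S) (maxT : maximal_monotone T).
Hypothesis clM : closed_subspace (cone_diff (pi1_dom_fitz S) (pi1_dom_fitz T)).

Lemma fitz_le_cone x s c y t d : is_dual s -> is_dual t ->
  fitz_le S x s c -> fitz_le T y t d ->
  cone_diff (pi1_dom_fitz S) (pi1_dom_fitz T) (x - y).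
Proof.
move=> ds dt Hs Ht; exists 1; split => //.
exists x; first exact: fitz_le_dom Hs.
by exists y; [exact: fitz_le_dom Ht|rewrite scale1r].
Qed.

(** Since 0 is in the cone of differences, the two projected domains share a point [a], of some
    level [n]. The ideally convex set is formed at level n + 1, whose extra room makes it
    absorbing. *)
Lemma fitz_level_diff_nbhs0 : exists n r : R, 0 < r /\
  forall v, cone_diff (pi1_dom_fitz S) (pi1_dom_fitz T) v -> `|v| < r ->
  exists x s y t, [/\ fitz_level S n x s, fitz_level T n y t & v = x - y].
Proof.
have [_ [M0 _]] := clM.
have [l [l0 [a Aa [b Bb ab]]]] := M0.
have {l l0} {}ab : a = b.
  by apply/eqP; move/esym/eqP: ab; rewrite scaler_eq0 gt_eqF //= subr_eq0.
subst b.
have [s [c [ds /(fitz_level_ex ds)[n1 n10 Hs]]]] := dom_fitz_le Aa.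
have [t [d [dt /(fitz_level_ex dt)[n2 n20 Ht]]]] := dom_fitz_le Bb.
pose n := n1 + n2; have n0 : 0 <= n by rewrite addr_ge0.
have {}Hs : fitz_level S n a s by apply: fitz_level_mono Hs; rewrite lerDl.
have {}Ht : fitz_level T n a t by apply: fitz_level_mono Ht; rewrite lerDr.
pose C := [set v | exists x s y t,
  [/\ fitz_level S (n + 1) x s, fitz_level T (n + 1) y t & v = x - y]].
have [|||| r r0 rC] := @ideally_convex_nbhs0 R E _ C clM.
- move=> _ [x [xs [y [ys [[dx fx _ _] [dy fy _ _] ->]]]]].
  exact: fitz_le_cone fx fy.
- move=> p q _ _ p0 q0 pq [x [xs [y [ys [Hx Hy ->]]]]] [x' [xs' [y' [ys' [Hx' Hy' ->]]]]].
  exists (p *: x + q *: x'), (fun v => p * xs v + q * xs' v),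
    (p *: y + q *: y'), (fun v => p * ys v + q * ys' v).
  have -> : n + 1 = p * (n + 1) + q * (n + 1) by rewrite -mulrDl pq mul1r.
  split; [exact: fitz_level_comb|exact: fitz_level_comb|].
  by rewrite !scalerBr opprD addrACA.
- move=> v w Cv vw.
  have [X /choice[Xs /choice[Z /choice[Zs HX]]]] := choice Cv.
  have [x [xs [cx Hx]]] := fitz_level_dyadic (fun i => let: And3 h _ _ := HX i in h).
  have [z [zs [cz Hz]]] := fitz_level_dyadic (fun i => let: And3 _ h _ := HX i in h).
  exists x, xs, z, zs; split => //.
  apply: (@cvg_unique _ (@norm_hausdorff _ E) _ _ _ _ vw).
  rewrite (_ : dyadic_sum v = (fun i => dyadic_sum X i - dyadic_sum Z i)).
    exact: cvgB.
  apply/funext => k; elim: k => [|k IH].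
    by rewrite /dyadic_sum !big_ord0 subrr.
  rewrite !dyadic_sumS IH; have [_ _ ->] := HX k.
  by rewrite scalerBr opprD addrACA.
- move=> m [l [l0 [x Ax [y By ->]]]].
  have [xs [e [dxs /(fitz_level_ex dxs)[m1 m10 Hx]]]] := dom_fitz_le Ax.
  have [ys [f [dys /(fitz_level_ex dys)[m2 m20 Hy]]]] := dom_fitz_le By.
  (* Weight 1/N on the pair (x, y) of level [N] and the rest on (a, a) of level [n] give a level of
     at most n + 1 and the difference (x - y) / N. The summand 1 ensures N >= 1. *)
  pose N := m1 + m2 + 1; have N0 : 0 < N by rewrite /N; lra.
  have {}Hx : fitz_level S N x xs by apply: fitz_level_mono Hx; rewrite /N; lra.
  have {}Hy : fitz_level T N y ys by apply: fitz_level_mono Hy; rewrite /N; lra.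
  have Ni0 : 0 < N^-1 by rewrite invr_gt0.
  have Ni1 : N^-1 <= 1 by rewrite invf_le1 // /N; lra.
  have lev : (1 - N^-1) * n + N^-1 * N <= n + 1.
    by rewrite mulVf ?gt_eqF // mulrBl mul1r; have := mulr_ge0 (ltW Ni0) n0; lra.
  have [q0 q1] : 0 <= 1 - N^-1 /\ 1 - N^-1 + N^-1 = 1 by split; lra.
  exists (N^-1 / l); first by rewrite divr_gt0.
  exists ((1 - N^-1) *: a + N^-1 *: x), (fun v => (1 - N^-1) * s v + N^-1 * xs v),
    ((1 - N^-1) *: a + N^-1 *: y), (fun v => (1 - N^-1) * t v + N^-1 * ys v).
  split.
  + by apply: (fitz_level_mono lev); apply: fitz_level_comb => //; exact: ltW.
  + by apply: (fitz_level_mono lev); apply: fitz_level_comb => //; exact: ltW.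
  + by rewrite scalerA divfK ?gt_eqF // scalerBr opprD addrACA subrr add0r.
by exists (n + 1), r.
Qed.

End LevelDifferences.

(** * The energy, its exact penalty and its linear minorant *)

Lemma sqr_convex (R : realFieldType) (a b u v : R) : 0 <= a -> 0 <= b -> a + b = 1 ->
  (a * u + b * v) ^+ 2 <= a * u ^+ 2 + b * v ^+ 2.
Proof.
move=> a0 b0 ab; rewrite -subr_ge0.
have -> : a * u ^+ 2 + b * v ^+ 2 - (a * u + b * v) ^+ 2 = a * b * (u - v) ^+ 2.
  have -> : b = 1 - a by lra.
  by ring.
by rewrite mulr_ge0 ?sqr_ge0 // mulr_ge0.
Qed.

Section Energy.
Variables (R : realType) (E : completeNormedModType R) (S T : multifun E).
Hypotheses (maxS : maximal_monotone S) (maxT : maximal_monotone T).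
Let M := cone_diff (pi1_dom_fitz S) (pi1_dom_fitz T).
Hypothesis clM : closed_subspace M.
Variables (z : E) (zs : E -> R).
Hypothesis dzs : is_dual zs.

(* Epigraph of the value function of
   [phi_S (x, s) + phi_T (y, t) - <x, zs> - <z, s + t> + <z, zs>
    + |x - z + e|^2 / 2 + |s + t - zs + rho|^2 / 2] under [x - y = w]. *)
Definition energy (w e : E) (rho : E -> R) (c : R) : Prop :=
  exists x s y t c1 c2 k,
  [/\ is_dual s, is_dual t, fitz_le S x s c1, fitz_le T y t c2 &
   [/\ 0 <= k, op_bound k (fun v => s v + t v - zs v + rho v), w = x - y &
    c1 + c2 - zs x - (s z + t z) + zs z +
      2^-1 * (`|x - z + e| ^+ 2 + k ^+ 2) <= c]].

(** The constraints and the squares are jointly convex in all the data, and the remaining terms are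
    affine. *)
Lemma energy_convex w e rho c w' e' rho' c' (a b : R) :
  0 <= a -> 0 <= b -> a + b = 1 ->
  energy w e rho c -> energy w' e' rho' c' ->
  energy (a *: w + b *: w') (a *: e + b *: e')
    (fun v => a * rho v + b * rho' v) (a * c + b * c').
Proof.
move=> a0 b0 ab [x [s [y [t [c1 [c2 [k [ds dt Hx Hy [k0 kb -> cle]]]]]]]]].
move=> [x' [s' [y' [t' [c1' [c2' [k' [ds' dt' Hx' Hy' [k0' kb' -> cle']]]]]]]]].
exists (a *: x + b *: x'), (fun v => a * s v + b * s' v),
  (a *: y + b *: y'), (fun v => a * t v + b * t' v),
  (a * c1 + b * c1'), (a * c2 + b * c2'), (a * k + b * k').
split; [exact: dual_comb|exact: dual_comb|exact: fitz_le_comb|exact: fitz_le_comb|].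
split.
- by rewrite addr_ge0 // mulr_ge0.
- move=> v; have := op_bound_comb a b kb kb' v; rewrite (ger0_norm a0) (ger0_norm b0).
  have zsv : zs v = a * zs v + b * zs v by rewrite -mulrDl ab mul1r.
  rewrite (_ : a * s v + b * s' v + (a * t v + b * t' v) - zs v + (a * rho v + b * rho' v)
    = a * (s v + t v - zs v + rho v) + b * (s' v + t' v - zs v + rho' v)) //; lra.
- by rewrite !scalerBr opprD addrACA.
- have nx : `|a *: x + b *: x' - z + (a *: e + b *: e')| ^+ 2 <=
      a * `|x - z + e| ^+ 2 + b * `|x' - z + e'| ^+ 2.
    apply: le_trans (sqr_convex _ _ a0 b0 ab); rewrite ler_sqr ?nnegrE //; last first.
      by rewrite addr_ge0 // mulr_ge0.
    have -> : a *: x + b *: x' - z + (a *: e + b *: e') =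
        a *: (x - z + e) + b *: (x' - z + e').
      rewrite -{1}[z]scale1r -ab scalerDl !scalerDr !scalerN opprD.
      by rewrite [in RHS]addrACA [X in X + _ = _]addrACA.
    by apply: (le_trans (ler_normD _ _)); rewrite !normrZ !ger0_norm.
  have nk := sqr_convex k k' a0 b0 ab.
  rewrite (dualD _ _ dzs) !(dualZ _ _ dzs).
  have zsz : zs z = a * zs z + b * zs z by rewrite -mulrDl ab mul1r.
  have := ler_wpM2l a0 cle; have := ler_wpM2l b0 cle'.
  rewrite !(mulrDr, mulrBr, mulrN); lra.
Qed.

(** For x = y the terms before the squares are at least <x - z, s + t - zs> >= - k |x - z|, and (k -
    |x - z|)^2 >= 0 absorbs this. *)
Lemma energy_ge0 c : energy 0 0 (fun _ => 0) c -> 0 <= c.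
Proof.
move=> [x [s [y [t [c1 [c2 [k [ds dt Hx Hy [k0 kb xy cle]]]]]]]]].
have {}xy : x = y by apply/eqP; rewrite -subr_eq0 -xy.
subst y.
have px := fitz_le_pairing maxS ds Hx; have py := fitz_le_pairing maxT dt Hy.
move: cle; rewrite addr0; apply: le_trans.
have : - (k * `|x - z|) <= s (x - z) + t (x - z) - zs (x - z) + 0.
  by have := kb (x - z); rewrite ler_norml => /andP[].
rewrite (dualB _ _ ds) (dualB _ _ dt) (dualB _ _ dzs).
have : 0 <= (k - `|x - z|) ^+ 2 by exact: sqr_ge0.
rewrite sqrrB mulr2n; set N := `|x - z|; lra.
Qed.

(** On the segment from [w] through 0 to the opposite point at distance [d], the value is at least 0
    at the origin and at most [K] at the far end; convexity then bounds [c] below by - (K / d)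
    |w|. *)
Lemma energy_penalty : exists2 L, 0 <= L &
  forall w c, energy w 0 (fun _ => 0) c -> 0 <= c + L * `|w|.
Proof.
have [n [r [r0 near0]]] := fitz_level_diff_nbhs0 maxS maxT clM.
have [kz kz0 kzb] := dual_bounded dzs.
have [_ [_ [_ MZ]]] := clM.
pose m := `|n|.
(* A term-by-term bound for the energy of two points of level [m]. *)
pose K := m + m + kz * m + (m * `|z| + m * `|z|) + kz * `|z| +
  2^-1 * ((m + `|z|) ^+ 2 + (m + m + kz) ^+ 2).
have m0 : 0 <= m by exact: normr_ge0.
have K0 : 0 <= K.
  rewrite /K; have kz0' := ltW kz0.
  by rewrite !addr_ge0 // ?mulr_ge0 // ?addr_ge0 // sqr_ge0.
have bdd v : M v -> `|v| < r -> energy v 0 (fun _ => 0) K.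
  move=> Mv vr; have [x [s [y [t [Hx Hy ->]]]]] := near0 v Mv vr.
  have [ds fx xm sm] := fitz_level_mono (ler_norm n) Hx.
  have [dt fy ym tm] := fitz_level_mono (ler_norm n) Hy.
  exists x, s, y, t, m, m, (m + m + kz); split => //; split => //.
  - by rewrite !addr_ge0 // ltW.
  - move=> v'; rewrite addr0 !mulrDl.
    by apply: (le_trans (ler_normB _ _)); apply: lerD => //;
      apply: (le_trans (ler_normD _ _)); apply: lerD.
  - rewrite addr0.
    have h1 : - zs x <= kz * m.
      rewrite -(dualN _ dzs); apply: (le_trans (ler_norm _)); apply: (le_trans (kzb _)).
      by rewrite normrN ler_wpM2l // ltW.
    have h2 : - s z <= m * `|z|.
      by rewrite -(dualN _ ds); apply: (le_trans (ler_norm _)); rewrite -[`|z|]normrN.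
    have h3 : - t z <= m * `|z|.
      by rewrite -(dualN _ dt); apply: (le_trans (ler_norm _)); rewrite -[`|z|]normrN.
    have h4 : zs z <= kz * `|z| by apply: (le_trans (ler_norm _)).
    have h5 : `|x - z| ^+ 2 <= (m + `|z|) ^+ 2.
      rewrite ler_sqr ?nnegrE // ?addr_ge0 //.
      by apply: (le_trans (ler_normB _ _)); rewrite lerD2r.
    rewrite /K; lra.
pose d := r / 2; have d0 : 0 < d by rewrite divr_gt0.
exists (K / d) => [|w c Hw]; first by rewrite divr_ge0 // ltW.
have [w0|w0] := eqVneq w 0.
  by move: Hw; rewrite w0 normr0 mulr0 addr0; exact: energy_ge0.
have nw : 0 < `|w| by rewrite normr_gt0.
have Mw : M w.
  case: Hw => [x [s [y [t [c1 [c2 [k [ds dt Hx Hy [_ _ -> _]]]]]]]]].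
  exact: fitz_le_cone Hx Hy.
have dw : 0 < d + `|w| by rewrite addr_gt0.
have Hv : energy ((- (d / `|w|)) *: w) 0 (fun _ => 0) K.
  apply: bdd; first exact: MZ.
  by rewrite normrZ normrN ger0_norm ?divfK ?gt_eqF // ?divr_ge0 // ?(ltW d0) // /d; lra.
have := energy_convex _ _ _ Hw Hv.
move=> /(_ (d / (d + `|w|)) (`|w| / (d + `|w|))).
move=> /(_ (ltW (divr_gt0 d0 dw)) (ltW (divr_gt0 nw dw))).
rewrite -mulrDl divff ?gt_eqF // => /(_ erefl).
have -> : (d / (d + `|w|)) *: w + (`|w| / (d + `|w|)) *: (- (d / `|w|) *: w) = 0.
  rewrite scalerA -scalerDl.
  have -> : d / (d + `|w|) + `|w| / (d + `|w|) * - (d / `|w|) = 0.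
    by field; rewrite !gt_eqF.
  by rewrite scale0r.
rewrite !scaler0 addr0.
rewrite (_ : (fun _ : E => _ + _) = (fun _ => 0)); last first.
  by apply/funext => v; rewrite !mulr0 addr0.
move=> /energy_ge0 H.
have -> : c + K / d * `|w| =
    (d + `|w|) / d * (d / (d + `|w|) * c + `|w| / (d + `|w|) * K).
  by field; rewrite !gt_eqF.
by rewrite mulr_ge0 // divr_ge0 // ltW.
Qed.

Hypothesis reflE : reflexive_space E.

Lemma energy_minorant : exists a p u, [/\ is_dual a, is_dual p &
  forall w e rho c, is_dual rho -> energy w e rho c -> a e + rho u - p w <= c].
Proof.
have [L L0 pen] := energy_penalty.
pose Y : lmodType R := (E * (E -> R^o) * E)%type.
(* The dual enters as a subspace of the module of all functions, in the middle component. *)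
pose Y0 : set Y := [set y | is_dual (y.1.2 : E -> R)].
(* Epigraph of (e, rho, w) -> inf over v of the energy at (v, e, rho) plus L |v + w|: the penalty
   leaves [w] unconstrained. *)
pose W : set (Y * R) := [set q | is_dual (q.1.1.2 : E -> R) /\
  exists w c, energy w q.1.1.1 q.1.1.2 c /\ c + L * `|w + q.1.2| <= q.2].
have [_ [M0 _]] := clM.
have [n [r [r0 near0]]] := fitz_level_diff_nbhs0 maxS maxT clM.
have [||x0 [s0 [y0 [t0 [[ds0 fx0 _ _] [dt0 fy0 _ _] _]]]]] := near0 0.
- exact: M0.
- by rewrite normr0.
have [k0 k0p k0b] : exists2 k, 0 < k & op_bound k (fun v => s0 v + t0 v - zs v).
  apply: dual_bounded.
  have -> : (fun v => s0 v + t0 v - zs v) =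
      (fun v => 1 * (1 * s0 v + 1 * t0 v) + (-1) * zs v).
    by apply/funext => v; rewrite !mul1r mulN1r.
  by apply: dual_comb => //; exact: dual_comb.
(* One fixed pair of points serves all perturbations, which alter only the squares. *)
have feas e rho k : 0 <= k -> op_bound k rho -> energy (x0 - y0) e rho
   (n + n - zs x0 - (s0 z + t0 z) + zs z + 2^-1 * (`|x0 - z + e| ^+ 2 + (k0 + k) ^+ 2)).
  move=> kp kb; exists x0, s0, y0, t0, n, n, (k0 + k); split => //; split => //.
    by rewrite addr_ge0 // ltW.
  by move=> v; rewrite mulrDl; apply: (le_trans (ler_normD _ _)); apply: lerD.
have [|||||||l [lin lW]] := @linear_minorant R Y Y0 W.
- exact: dual_zero.
- move=> u v du dv; have := dual_comb 1 1 du dv.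
  by under eq_fun do rewrite !mul1r.
- move=> a u du; have := dual_comb a 0 du du.
  by under eq_fun do rewrite mul0r addr0.
- by move=> y c [].
- move=> a b [[e rho] w] c [[e' rho'] w'] c' a0 b0 ab /= [/= d1 [v [d [Hv dc]]]].
  move=> [/= d1' [v' [d' [Hv' dc']]]]; split; first exact: (dual_comb a b d1 d1').
  exists (a *: v + b *: v'), (a * d + b * d'); split.
    exact: (energy_convex (ltW a0) (ltW b0) ab Hv Hv').
  have := ler_wpM2l (ltW a0) dc; have := ler_wpM2l (ltW b0) dc'.
  have : `|a *: v + b *: v' + (a *: w + b *: w')| <= a * `|v + w| + b * `|v' + w'|.
    rewrite addrACA -!scalerDr; apply: (le_trans (ler_normD _ _)).
    by rewrite !normrZ !gtr0_norm.
  by move=> /(ler_wpM2l L0) /=; rewrite !mulrDr !(mulrCA L); lra.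
- move=> c [/= _ [w [d [Hw]]]]; rewrite addr0; apply: le_trans; exact: pen.
- move=> [[e rho] w] drho; have [k k1 kb] := dual_bounded drho.
  have H := feas e rho k (ltW k1) kb; eexists; split => //=.
  by eexists; eexists; split; [exact: H|exact: lexx].
(* Bounds the convex function when [e], [rho] and [w] lie in their unit balls; this makes the
   components of [l] continuous. *)
pose A : R := n + n - zs x0 - (s0 z + t0 z) + zs z +
  2^-1 * ((`|x0 - z| + 1) ^+ 2 + (k0 + 1) ^+ 2) + L * (`|x0 - y0| + 1).
have lA (e : E) (rho : E -> R) (w : E) : `|e| <= 1 -> is_dual rho -> op_bound 1 rho ->
    `|w| <= 1 -> l (e, rho, w) <= A.
  move=> e1 drho rho1 w1; apply: lW; split => //=.
  eexists; eexists; split; first exact: (feas e rho 1 ler01 rho1).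
  apply: lerD.
    rewrite lerD2l ler_pM2l ?invr_gt0 // lerD2r ler_sqr ?nnegrE ?addr_ge0 //.
    by apply: (le_trans (ler_normD _ _)); rewrite lerD2l.
  by apply: ler_wpM2l => //; apply: (le_trans (ler_normD _ _)); rewrite lerD2l.
have dz := dual_zero E.
have bz : op_bound 1 (fun _ : E => 0 : R) by move=> v; rewrite normr0 mul1r.
pose a v := l (v, fun _ => 0, 0).
pose p v := l (0, fun _ => 0, v).
pose Phi (f : E -> R) := l (0, f, 0).
have linY (b : R) e rho w e' rho' w' : is_dual rho -> is_dual rho' ->
    l (b *: e + e', (fun v => b * rho v + rho' v), b *: w + w') =
    b * l (e, rho, w) + l (e', rho', w').
  by move=> drho drho'; exact: (lin b (e, rho, w) (e', rho', w')).
have funz (b : R) : (fun _ : E => b * 0 + 0) = (fun _ => 0 : R).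
  by apply/funext => v; rewrite mulr0 addr0.
have da : is_dual a.
  apply: (dual_of_unit_bound (B := A)) => [b u v|v v1].
    by rewrite -linY // funz scaler0 addr0.
  by apply: lA => //; rewrite normr0.
have dp : is_dual p.
  apply: (dual_of_unit_bound (B := A)) => [b u v|v v1].
    by rewrite -linY // funz scaler0 addr0.
  by apply: lA => //; rewrite normr0.
have linPhi (b : R) f g : is_dual f -> is_dual g ->
    Phi (fun v => b * f v + g v) = b * Phi f + Phi g.
  by move=> df dg; rewrite -linY // scaler0 addr0.
have Phi0 : Phi (fun _ => 0) = 0.
  by have := linPhi 1 _ _ dz dz; rewrite funz; lra.
have PhiZ b f : is_dual f -> Phi (fun v => b * f v) = b * Phi f.
  move=> df; have := linPhi b _ _ df dz; rewrite Phi0 addr0 => <-.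
  by congr Phi; apply/funext => v; rewrite addr0.
have dualZf b (f : E -> R) : is_dual f -> is_dual (fun v => b * f v).
  move=> df; have := dual_comb b 0 df df.
  by under eq_fun do rewrite mul0r addr0.
have Phi_le k f : 0 < k -> is_dual f -> op_bound k f -> Phi f <= A * k.
  move=> kp df fk; rewrite -ler_pdivrMr // mulrC -PhiZ //; apply: lA; rewrite ?normr0 //.
    exact: dualZf.
  move=> v; rewrite normrM gtr0_norm ?invr_gt0 // mul1r ler_pdivrMl //; exact: fk.
(* [Phi] is bounded by [A] on the dual unit ball, hence norm continuous, and reflexivity represents
   it by a point. *)
have [u Phiu] : exists u : E, forall f, is_dual f -> Phi f = f u.
  apply: reflE => [b f g df dg|f0 df0 e e0]; first exact: linPhi.
  have A0 : 0 < `|A| + 1 by apply: ltr_pwDr.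
  exists (e / (`|A| + 1) / 2) => [|f df fd]; first by rewrite !divr_gt0.
  set d := e / (`|A| + 1) / 2 in fd *.
  have d0 : 0 < d by rewrite !divr_gt0.
  pose g := fun x => f x - f0 x.
  have gE (b : R) : (fun v => b * g v) = (fun v => b * f v + - b * f0 v).
    by apply/funext => v; rewrite /g; ring.
  have dg : is_dual g.
    rewrite (_ : g = fun v => 1 * g v); first by rewrite gE; exact: dual_comb.
    by apply/funext => v; rewrite mul1r.
  have gd b : `|b| = 1 -> op_bound d (fun v => b * g v).
    move=> b1 v; rewrite normrM b1 mul1r.
    by apply: (le_trans (dnorm_op_bound dg v)); apply: ler_wpM2r => //; exact: ltW.
  have -> : Phi f - Phi f0 = Phi g.
    have := linPhi (-1) f0 f df0 df; rewrite mulN1r addrC => <-.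
    by congr Phi; apply/funext => v; rewrite mulN1r addrC.
  have Ad : A * d < e.
    apply: (@le_lt_trans _ _ ((`|A| + 1) * d)).
      by rewrite ler_pM2r //; have := ler_norm A; lra.
    by rewrite /d !mulrA [_ * e]mulrC mulfK ?gt_eqF //; lra.
  rewrite ltr_norml; apply/andP; split.
    rewrite ltrNl; apply: le_lt_trans Ad; rewrite -mulN1r -PhiZ //.
    by apply: Phi_le => //; [exact: dualZf|apply: gd; rewrite normrN normr1].
  apply: le_lt_trans Ad; rewrite -[Phi g]mul1r -PhiZ //.
  by apply: Phi_le => //; [exact: dualZf|apply: gd; rewrite normr1].
exists a, p, u; split => // w e rho c drho Hw.
(* The third argument - w cancels the penalty. *)
have : l (e, rho, - w) <= c.
  apply: lW; split => //=; exists w, c; split => //.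
  by rewrite subrr normr0 mulr0 addr0.
have -> : l (e, rho, - w) = a e + rho u + p (- w).
  have := linY 1 e (fun _ => 0) 0 0 rho (- w) dz drho.
  have := linY 1 0 rho 0 0 (fun _ => 0) (- w) drho dz.
  rewrite !scale1r !add0r !addr0 !mul1r -/(a e) -/(p _) -/(Phi _) Phiu //.
  rewrite (_ : (fun v => 1 * rho v + 0) = rho); last first.
    by apply/funext => v; rewrite mul1r addr0.
  rewrite (_ : (fun v => 0 + rho v) = rho); last first.
    by apply/funext => v; rewrite add0r.
  by move=> -> ->; rewrite addrA.
by rewrite (dualN _ dp).
Qed.

Lemma sum_graph_of_related :
  (forall q, graph (mf_sum S T) q -> 0 <= zs (z - q.1) - q.2 (z - q.1)) ->
  graph (mf_sum S T) (z, zs).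
Proof.
move=> rel.
have [a [p [u [da dp min]]]] := energy_minorant.
(* The perturbations z - x + e and zs - s - t + r turn the arguments of the two squares into [e] and
   [r]. *)
have main q q' e r k : graph S q -> graph T q' -> is_dual r -> 0 <= k -> op_bound k r ->
    (q.2 (z - u) + (zs q.1 - a q.1 - p q.1) - q.2 q.1) +
    (q'.2 (z - u) + p q'.1 - q'.2 q'.1) <=
    zs z - a z - zs u - (a e + r u - 2^-1 * (`|e| ^+ 2 + k ^+ 2)).
  case: q q' => [x s] [y t] Sx Ty dr k0 kr /=.
  have [/= ds _] := Sx; have [/= dt _] := Ty.
  pose rho v := 1 * (1 * zs v + -1 * (1 * s v + 1 * t v)) + 1 * r v.
  have drho : is_dual rho by do !apply: dual_comb.
  have := min (x - y) (z - x + e) rho (s x + t y - zs x - (s z + t z) + zs z +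
      2^-1 * (`|e| ^+ 2 + k ^+ 2)) drho.
  have en : energy (x - y) (z - x + e) rho (s x + t y - zs x - (s z + t z) + zs z +
      2^-1 * (`|e| ^+ 2 + k ^+ 2)).
    exists x, s, y, t, (s x), (t y), k; split => //.
    - exact: (fitz_le_graph maxS Sx).
    - exact: (fitz_le_graph maxT Ty).
    - split => //.
        move=> v; rewrite (_ : _ + _ = r v); first exact: kr.
        by rewrite /rho; ring.
      by rewrite -(opprB x z) addNKr.
  move=> /(_ en); rewrite (dualD _ _ da) (dualB _ _ da) (dualB _ _ dp)
    (dualB _ _ ds) (dualB _ _ dt) /rho; lra.
pose us v := 1 * (1 * zs v + -1 * a v) + -1 * p v.
have dus : is_dual us by do !apply: dual_comb.
have usE v : us v = zs v - a v - p v by rewrite /us; ring.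
have [r [dr ru rE]] := norming_functional u.
(* At e = - u, with [r] the norming functional of [u], the last bracket of [main] reduces to - a
   u. *)
have sum_le q q' : graph S q -> graph T q' ->
    (q.2 (z - u) + us q.1 - q.2 q.1) + (q'.2 (z - u) + p q'.1 - q'.2 q'.1) <=
    us (z - u) + p (z - u).
  move=> Sq Tq; rewrite !usE; apply: (le_trans (main q q' (- u) r _ Sq Tq dr _ ru)) => //.
  by rewrite rE normrN (dualB _ _ dzs) (dualB _ _ da) (dualN _ da); lra.
(* A term of phi_S above us (z - u) would force phi_T (z - u, p) below the pairing p (z - u). *)
have Su : graph S (z - u, us).
  apply: (graph_fitz_le maxS dus) => q Sq; rewrite leNgt; apply/negP => lt.
  have : p (z - u) <= us (z - u) + p (z - u) - (q.2 (z - u) + us q.1 - q.2 q.1).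
    apply: (fitz_le_pairing maxT dp) => q' Tq'.
    by have := sum_le _ _ Sq Tq'; lra.
  by move: lt; lra.
(* The point just found contributes exactly us (z - u) to [sum_le]. *)
have Tu : graph T (z - u, p).
  apply: (graph_fitz_le maxT dp) => q Tq.
  by have := sum_le _ _ Su Tq; rewrite /=; lra.
have au0 : 0 <= a u.
  have /rel /= : graph (mf_sum S T) (z - u, fun v => us v + p v).
    split; last by exists us, p.
    by have := dual_comb 1 1 dus dp; under eq_fun do rewrite !mul1r.
  by rewrite subKr !usE; lra.
(* Both new graph points are inserted in [main], while the perturbation stays free. *)
have slack e r' k : is_dual r' -> 0 <= k -> op_bound k r' ->
    a u + a e + r' u <= 2^-1 * (`|e| ^+ 2 + k ^+ 2).
  move=> dr' k0 kr'; have := main _ _ e r' k Su Tu dr' k0 kr'.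
  by rewrite /= (dualB _ _ dzs) (dualB _ _ da); lra.
(* For e = 0 and the norming functional, [slack] and a u >= 0 give |u|^2 <= |u|^2 / 2. *)
have u0 : u = 0.
  suff /eqP : `|u| ^+ 2 = 0 by rewrite expf_eq0 /= normr_eq0 => /eqP.
  have := slack 0 r _ dr (normr_ge0 u) ru; have := sqr_ge0 `|u|.
  by rewrite (dual0 da) normr0 rE expr0n /=; lra.
have a0 v : a v = 0.
  have le (t : R) : t * a v <= 2^-1 * (t ^+ 2 * `|v| ^+ 2).
    have := slack (t *: v) (fun _ => 0) 0 (dual_zero E) (lexx _).
    rewrite (dualZ _ _ da) normrZ exprMn real_normK ?num_real // expr0n /= !addr0.
    rewrite u0 (dual0 da) add0r; apply.
    by move=> w; rewrite normr0 mul0r.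
  have N0 : 0 <= `|v| ^+ 2 by exact: sqr_ge0.
  have N1 : 0 < `|v| ^+ 2 + 1 by apply: ltr_wpDl.
  (* Then t^2 (|v|^2 + 1) <= t^2 |v|^2 / 2, so t = 0; the summand 1 keeps the denominator positive
     at v = 0. *)
  pose t := a v / (`|v| ^+ 2 + 1).
  have avE : a v = t * (`|v| ^+ 2 + 1) by rewrite /t divfK // gt_eqF.
  have t2 : t ^+ 2 = 0.
    apply/eqP; rewrite eq_le sqr_ge0 andbT.
    have := le t; have := mulr_ge0 (sqr_ge0 t) N0.
    rewrite avE mulrDr mulr1 mulrDr mulrA -expr2; lra.
  by move/eqP: t2; rewrite expf_eq0 /= avE => /eqP ->; rewrite mul0r.
have usz : us = (fun v => zs v - p v).
  by apply/funext => v; rewrite usE a0 subr0.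
split => //; exists us, p; split => /=; first by rewrite -[z]subr0 -u0.
split; first by rewrite -[z]subr0 -u0.
by apply/funext => v; rewrite usz subrK.
Qed.

End Energy.

Theorem theorem6p5 (R : realType) (E : completeNormedModType R)
  (S T : multifun E) :
  (exists x : E, x != 0) ->
  reflexive_space E ->
  maximal_monotone S -> maximal_monotone T ->
  closed_subspace (cone_diff (pi1_dom_fitz S) (pi1_dom_fitz T)) ->
  maximal_monotone (mf_sum S T).
Proof.
move=> _ reflE maxS maxT clM; split; last first.
  by move=> z zs dzs; apply: sum_graph_of_related.
move=> [x f] [y g] [/= _ [f1 [f2 [Sx [Tx ->]]]]] [/= _ [g1 [g2 [Sy [Ty ->]]]]].
have := (proj1 maxS) _ _ Sx Sy; have := (proj1 maxT) _ _ Tx Ty; rewrite /=; lra.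
Qed.
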